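(* Let $(X,E)$ be a finite weighted graph with weights $\mu,g$, let $q:X\to\mathbb{R}$ be a potential function and let $B\subset X$. Assume that there does not exist a nonzero eigenfunction of the Schrödinger operator $-\Delta_X+q$ vanishing identically on $B$. If $\mu|_B$ is known, then the inverse problems of determining $(X,E)$, $\mu$, $g$, $q$ from $B$ and the source-to-solution map $\Lambda^c$ (continuous-time heat equation), $\Lambda^s$ (continuous-time Schrödinger equation), or $\Lambda^d$ (discrete-time heat equation) are each equivalent to the inverse interior spectral problem, i.e. to determining them from the interior spectral data on $B$, in the sense that the data determine each other. Precisely: let $(X',E',\mu',g',q')$ be another finite weighted graph with potential and $B'\subset X'$ such that no nonzero eigenfunction of $-\Delta_{X'}+q'$ vanishes identically on $B'$. Let $\Phi_0:B\to B'$ be a bijection with $\mu'_{\Phi_0(b)}=\mu_b$ for all $b\in B$. Then the following are equivalent: (i) the interior spectral data of $(X,E,\mu,g,q)$ on $B$ and of $(X',E',\mu',g',q')$ on $B'$ coincide via $\Phi_0$; (ii) the maps $\Lambda^c$ for $(X,B)$ and $(X',B')$ coincide via $\Phi_0$; (iii) the maps $\Lambda^s$ for $(X,B)$ and $(X',B')$ coincide via $\Phi_0$; (iv) the maps $\Lambda^d$ for $(X,B)$ and $(X',B')$ coincide via $\Phi_0$.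
   Context: Graphs are finite, undirected and simple; $x\sim y$ means $\{x,y\}\in E$; $\mathbb{N}=\{0,1,2,\dots\}$, $\mathbb{Z}_+=\{1,2,\dots\}$, $\mathbb{R}_+=(0,\infty)$. A weighted graph carries a measure $\mu_x>0$ on each vertex and a symmetric weight $g_{xy}=g_{yx}>0$ on each edge. The graph Laplacian is $(\Delta_X u)(x)=\frac{1}{\mu_x}\sum_{y\sim x}g_{xy}(u(y)-u(x))$, $x\in X$; $\langle u_1,u_2\rangle_{L^2(X)}=\sum_{x\in X}\mu_x u_1(x)u_2(x)$ for real functions. Interior spectral data on $B$: $(\lambda_j,\phi_j|_B)_{j=1}^{|X|}$, where $\{\phi_j\}_{j=1}^{|X|}$ is a complete $L^2(X)$-orthonormal family of (real) eigenfunctions, $-\Delta_X\phi_j+q\phi_j=\lambda_j\phi_j$ on all of $X$. The data coincide via $\Phi_0$ if $|X|=|X'|$ and there are such families $\{\phi_j\}$ on $X$ and $\{\phi'_j\}$ on $X'$ with $\lambda_j=\lambda'_j$ and $\phi_j|_B=\phi'_j\circ\Phi_0$ for all $j$. Source-to-solution maps. Sources vanish outside $B$ and, in the continuous-time cases, are continuous in $t$. - $\Lambda^cf=\Phi^f|_{B\times\mathbb{R}_+}$, where $f$ is real-valued with $\operatorname{supp}(f)\subset B\times\mathbb{R}_{\ge0}$ and $\Phi^f:X\times\mathbb{R}_{\ge0}\to\mathbb{R}$ solves $\partial_t\Phi-\Delta_X\Phi+q\Phi=f$ on $X\times\mathbb{R}_{\ge 0}$, $\Phi(\cdot,0)=0$.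 - $\Lambda^sf=\Psi^f|_{B\times\mathbb{R}_+}$, where $f$ is complex-valued with $\operatorname{supp}(f)\subset B\times\mathbb{R}_{\ge0}$ and $\Psi^f:X\times\mathbb{R}_{\ge0}\to\mathbb{C}$ solves $i\partial_t\Psi-\Delta_X\Psi+q\Psi=f$ on $X\times\mathbb{R}_{\ge 0}$, $\Psi(\cdot,0)=0$. - $\Lambda^df=u^f|_{B\times\mathbb{Z}_+}$, where $f$ is real-valued with $\operatorname{supp}(f)\subset B\times\mathbb{N}$ and $u^f:X\times\mathbb{N}\to\mathbb{R}$ solves $D_tu-\Delta_Xu+qu=f$ on $X\times\mathbb{N}$, $u(\cdot,0)=0$, with $D_tu(x,t)=u(x,t+1)-u(x,t)$. Two such maps $\Lambda$ (for $(X,B)$) and $\Lambda'$ (for $(X',B')$) coincide via $\Phi_0$ if $(\Lambda f)(b,t)=(\Lambda'f')(\Phi_0(b),t)$ for all $b\in B$ and all positive times $t$, whenever $f'(\Phi_0(b),t)=f(b,t)$ for all $b\in B$ and all $t$. *)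

(* Defs.v *)
From HB Require Import structures.
From mathcomp Require Export all_boot all_order all_algebra complex.
From mathcomp Require Export all_classical all_reals all_analysis.

Set Implicit Arguments.
Unset Strict Implicit.
Unset Printing Implicit Defensive.

Export Order.TTheory GRing.Theory Num.Theory numFieldNormedType.Exports.

Local Open Scope classical_set_scope.
Local Open Scope ring_scope.
Local Open Scope complex_scope.

(* The values of [weight] off the edges are irrelevant. *)
Record wgraph (R : realType) (X : finType) := WGraph {
  adj : rel X;
  adj_sym : symmetric adj;
  adj_irr : irreflexive adj;
  mu : X -> R;
  mu_gt0 : forall x, 0 < mu x;
  weight : X -> X -> R;
  weight_sym : forall x y, adj x y -> weight x y = weight y x;
  weight_gt0 : forall x y, adj x y -> 0 < weight x y }.

Section Operators.
Context (R : realType) (X : finType).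
Implicit Types (G : wgraph R X) (q : X -> R).

Definition laplacian G (u : X -> R) (x : X) : R :=
  (mu G x)^-1 * \sum_(y | adj G x y) weight G x y * (u y - u x).

(* [(R[i])^o] is [R[i]] viewed as a normed space over itself, which is how it
   gets its usual topology. *)
Definition claplacian G (u : X -> (R[i])^o) (x : X) : (R[i])^o :=
  (mu G x)^-1%:C * \sum_(y | adj G x y) (weight G x y)%:C * (u y - u x).

Definition l2 G (u v : X -> R) : R := \sum_x mu G x * u x * v x.

Definition eigen_eq G q (lam : R) (u : X -> R) : Prop :=
  forall x, - laplacian G u x + q x * u x = lam * u x.

Definition eigenfunction G q (lam : R) (u : X -> R) : Prop :=
  (exists x, u x != 0) /\ eigen_eq G q lam u.

Definition no_vanishing_eigenfunction G q (B : {set X}) : Prop :=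
  ~ exists lam u, eigenfunction G q lam u /\ forall x, x \in B -> u x = 0.

Definition orthonormal_eigenbasis G q n (lam : 'I_n -> R)
    (phi : 'I_n -> X -> R) : Prop :=
  [/\ n = #|X|,
      forall j, eigenfunction G q (lam j) (phi j),
      forall j k, l2 G (phi j) (phi k) = (j == k)%:R &
      forall u : X -> R, exists c : 'I_n -> R,
        forall x, u x = \sum_j c j * phi j x].

End Operators.

(* Time derivatives of functions on the half-line [0, +oo[ (extended by
   arbitrary values to negative times): two-sided for [0 < t], one-sided at
   [t = 0]. *)
Definition has_deriv_ge0 (R : realType) (u : R -> R) (t l : R) : Prop :=
  (fun s => (u s - u t) / (s - t)) @ within `[0, +oo[ t^' --> l.

Definition has_cderiv_ge0 (R : realType) (u : R -> (R[i])^o) (t : R)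
    (l : (R[i])^o) : Prop :=
  (fun s => (u s - u t) / (s - t)%:C : (R[i])^o) @ within `[0, +oo[ t^' --> l.

(* Each initial value problem is linear on a finite-dimensional space and has
   exactly one solution for t >= 0, which [get] selects; the values at t < 0 are
   never used. *)
Section SourceToSolution.
Context (R : realType) (X : finType) (G : wgraph R X) (q : X -> R).
Context (B : {set X}).

Definition source_c (f : X -> R -> R) : Prop :=
  (forall x (t : R), x \notin B -> 0 <= t -> f x t = 0) /\
  (forall x, {within `[0, +oo[, continuous (f x)}).

Definition solution_c (f Phi : X -> R -> R) : Prop :=
  (forall x, Phi x 0 = 0) /\
  (forall x (t : R), 0 <= t -> exists2 dPhi : R, has_deriv_ge0 (Phi x) t dPhi &
     dPhi - laplacian G (Phi^~ t) x + q x * Phi x t = f x t).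

Definition Lambda_c (f : X -> R -> R) (b : {x | x \in B}) (t : R) : R :=
  get (solution_c f) (val b) t.

Definition source_s (f : X -> R -> (R[i])^o) : Prop :=
  (forall x (t : R), x \notin B -> 0 <= t -> f x t = 0) /\
  (forall x, {within `[0, +oo[, continuous (f x)}).

Definition solution_s (f Psi : X -> R -> (R[i])^o) : Prop :=
  (forall x, Psi x 0 = 0) /\
  (forall x (t : R), 0 <= t -> exists2 dPsi : (R[i])^o,
     has_cderiv_ge0 (Psi x) t dPsi &
     (0 +i* 1) * dPsi - claplacian G (Psi^~ t) x + (q x)%:C * Psi x t = f x t).

Definition Lambda_s (f : X -> R -> (R[i])^o) (b : {x | x \in B}) (t : R)
  : (R[i])^o := get (solution_s f) (val b) t.

Definition source_d (f : X -> nat -> R) : Prop :=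
  forall x t, x \notin B -> f x t = 0.

Definition solution_d (f u : X -> nat -> R) : Prop :=
  (forall x, u x 0%N = 0) /\
  (forall x t,
     (u x t.+1 - u x t) - laplacian G (u^~ t) x + q x * u x t = f x t).

Definition Lambda_d (f : X -> nat -> R) (b : {x | x \in B}) (t : nat) : R :=
  get (solution_d f) (val b) t.

End SourceToSolution.

Section Coincidence.
Context (R : realType) (X X' : finType) (G : wgraph R X) (G' : wgraph R X').
Context (q : X -> R) (q' : X' -> R) (B : {set X}) (B' : {set X'}).
Context (Phi0 : {x | x \in B} -> {x | x \in B'}).

(* The common size n of the two eigenbases forces #|X| = #|X'|. *)
Definition spectral_data_coincide : Prop :=
  exists (n : nat) (lam : 'I_n -> R) (phi : 'I_n -> X -> R)
         (phi' : 'I_n -> X' -> R),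
    [/\ orthonormal_eigenbasis G q lam phi,
        orthonormal_eigenbasis G' q' lam phi' &
        forall j (b : {x | x \in B}), phi j (val b) = phi' j (val (Phi0 b))].

Definition Lambda_c_coincide : Prop :=
  forall f f', source_c B f -> source_c B' f' ->
    (forall b (t : R), 0 <= t -> f' (val (Phi0 b)) t = f (val b) t) ->
    forall b (t : R), 0 < t ->
      Lambda_c G q f b t = Lambda_c G' q' f' (Phi0 b) t.

Definition Lambda_s_coincide : Prop :=
  forall f f', source_s B f -> source_s B' f' ->
    (forall b (t : R), 0 <= t -> f' (val (Phi0 b)) t = f (val b) t) ->
    forall b (t : R), 0 < t ->
      Lambda_s G q f b t = Lambda_s G' q' f' (Phi0 b) t.

Definition Lambda_d_coincide : Prop :=
  forall f f', source_d B f -> source_d B' f' ->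
    (forall b t, f' (val (Phi0 b)) t = f (val b) t) ->
    forall b t, (0 < t)%N ->
      Lambda_d G q f b t = Lambda_d G' q' f' (Phi0 b) t.

End Coincidence.

(* Main.v *)
Require Import Defs.
From mathcomp Require Import ring lra.

(** Write H = -Delta + q, which is self-adjoint for the weight mu, and write
    1_c for the indicator of a vertex c. The interior spectral data and each
    of the three source-to-solution maps carry the same information as the
    moments (H^k 1_c)(b), for b, c in B and k >= 0, together with mu on B.

    From spectral data to measurements ([spectral_data_measurements]). The
    coefficient c_j(t) = <u(t), phi_j> of a solution u solves a scalar equation
    whose coefficient is lambda_j and whose forcing <f(t), phi_j> only involves
    f, mu and phi_j on B. So sum_j c_j(t) phi'_j solves the problem on X' with
    the corresponding source; by uniqueness it is the solution there, and on B'
    it takes the values of u on B. In particular a source is solvable on one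
    graph exactly when the corresponding one is solvable on the other.

    From measurements to moments ([moments_of_solutions]). Take the source 1_c,
    constant in time. If H^k u and H'^k u' agree on B at all times, then so do
    their time derivatives H^k 1_c - H^(k+1) u and H'^k 1_c' - H'^(k+1) u'. At
    time 0, where u = 0, this is the k-th moment identity; subtracting it gives
    the agreement of H^(k+1) u and H'^(k+1) u', and the induction goes on.

    From moments to spectral data ([moments_to_spectral_data]). The pairs
    (H^k 1_c, H'^k 1_c') span a linear relation between functions on X and
    functions on X' that commutes with the operators. Self-adjointness turns
    the inner product of H^k 1_b and H^l 1_c into a moment of order k + l, so
    the relation preserves inner products. An eigenfunction orthogonal to every
    H^k 1_c vanishes on B, hence does not exist, so that X has an orthonormal
    eigenbasis inside the domain of the relation ([twin_eigenbasis]). Its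
    partners on X' are orthonormal eigenfunctions with the same eigenvalues and
    the same values on B, and exchanging X and X' shows |X| = |X'|.

    The three equations differ in the meaning of the time derivative only. What
    the first two steps use about it is collected in [evolution_law], and
    checked in [discrete_law], [heat_law] and [schrodinger_law]. *)

Set Implicit Arguments.
Unset Strict Implicit.
Unset Printing Implicit Defensive.

Local Open Scope ring_scope.

(** * The Schrodinger operator as a symmetric kernel *)

Lemma pred_eqfun (A B : Type) (P : (A -> B) -> Prop) (u v : A -> B) :
  u =1 v -> P u -> P v.
Proof. by move=> /funext ->. Qed.

Section Operator.
Context (R : realType) (X : finType) (G : wgraph R X) (q : X -> R).

(** Matrix entries of -Delta + q. Once the operator is given by a kernel that is
    symmetric for mu, adjacency and edge weights are not mentioned any more. *)
Definition kernel (x y : X) : R :=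
  (if x == y then q x + (mu G x)^-1 * \sum_(z | adj G x z) weight G x z else 0)
  - (mu G x)^-1 * (if adj G x y then weight G x y else 0).

Lemma kernel_sym x y : mu G x * kernel x y = mu G y * kernel y x.
Proof.
rewrite /kernel eq_sym; have [->//|_] := eqVneq y x.
rewrite !sub0r !mulrN !mulrA !divff ?gt_eqF ?mu_gt0// !mul1r (adj_sym G y).
by case: ifP => // /weight_sym ->.
Qed.

Context (K : comNzRingType) (iota : {rmorphism R -> K}).

Definition schrodinger (u : X -> K) (x : X) : K :=
  \sum_y iota (kernel x y) * u y.

Definition dot (u v : X -> K) : K := \sum_x iota (mu G x) * u x * v x.

Lemma schrodingerE u x : schrodinger u x =
  - (iota (mu G x)^-1 * \sum_(y | adj G x y) iota (weight G x y) * (u y - u x))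
  + iota (q x) * u x.
Proof.
have mulif (b : bool) (y z : K) :
    (if b then y else 0) * z = if b then y * z else 0.
  by case: b; rewrite ?mul0r.
rewrite /schrodinger /kernel.
under eq_bigr => y _.
  rewrite rmorphB mulrBl rmorphM (fun_if iota) (fun_if iota) rmorph0.
  rewrite -mulrA !mulif eq_sym.
  over.
rewrite sumrB -mulr_sumr -!big_mkcond big_pred1_eq /=.
under [in RHS]eq_bigr => y _ do rewrite mulrBr.
rewrite sumrB mulrBr opprB rmorphD mulrDl rmorphM rmorph_sum -mulr_suml.
by rewrite -mulrA; ring.
Qed.

Lemma schrodinger_lin a (u v : X -> K) x :
  schrodinger (fun y => a * u y + v y) x = a * schrodinger u x + schrodinger v x.
Proof.
rewrite /schrodinger mulr_sumr -big_split/=; apply: eq_bigr => y _.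
by ring.
Qed.

Lemma iter_schrodinger_lin k a (u v : X -> K) x :
  iter k schrodinger (fun y => a * u y + v y) x =
  a * iter k schrodinger u x + iter k schrodinger v x.
Proof.
elim: k x => //= k IH x; rewrite -schrodinger_lin; congr (schrodinger _ _).
exact/funext.
Qed.

Lemma dotC u v : dot u v = dot v u.
Proof. by apply: eq_bigr => x _; rewrite mulrAC. Qed.

Lemma dot_lin a u v w : dot (fun x => a * u x + v x) w = a * dot u w + dot v w.
Proof.
rewrite /dot mulr_sumr -big_split/=; apply: eq_bigr => x _; ring.
Qed.

(** Exchanging the two sums moves the kernel from one argument to the other, by
    [kernel_sym]. *)
Lemma schrodinger_selfadjoint u v : dot (schrodinger u) v = dot u (schrodinger v).
Proof.
rewrite /dot /schrodinger.
under eq_bigr => x _ do rewrite mulr_sumr mulr_suml.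
under [RHS]eq_bigr => x _ do rewrite mulr_sumr.
rewrite exchange_big /=; apply: eq_bigr => x _; apply: eq_bigr => y _.
rewrite mulrA -rmorphM kernel_sym rmorphM; ring.
Qed.

Definition indicator (c x : X) : K := (x == c)%:R.

Lemma dot_indicator u c : dot u (indicator c) = iota (mu G c) * u c.
Proof.
rewrite /dot (bigD1 c)//= big1 /indicator => [|x /negPf->]; last by rewrite mulr0.
by rewrite eqxx mulr1 addr0.
Qed.

End Operator.

Arguments indicator {X K}.

(** The spectral theory is over the reals; the evolution equations use the same
    operator over the reals or, for the Schrodinger equation, over the complex
    numbers. *)
Notation real_schrodinger G q := (schrodinger G q idfun).

Section Spectral.
Context (R : realType) (X : finType) (G : wgraph R X) (q : X -> R).
Local Notation H := (real_schrodinger G q).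

Lemma eigen_eqP lam u :
  eigen_eq G q lam u <-> forall x, H u x = lam * u x.
Proof. by split=> e x; have := e x; rewrite schrodingerE. Qed.

Lemma l2_ge0 (u : X -> R) : 0 <= l2 G u u.
Proof.
by apply: sumr_ge0 => x _; rewrite -mulrA mulr_ge0 ?sqr_ge0// ltW// mu_gt0.
Qed.

Lemma l2_eq0 (u : X -> R) : l2 G u u = 0 -> forall x, u x = 0.
Proof.
have p x : 0 <= mu G x * u x * u x.
  by rewrite -mulrA mulr_ge0 ?sqr_ge0// ltW// mu_gt0.
move/eqP; rewrite psumr_eq0// => /allP h x.
have := h x (mem_index_enum _); rewrite /= -mulrA mulf_eq0 gt_eqF ?mu_gt0//=.
by rewrite mulf_eq0 orbb => /eqP.
Qed.

Lemma l2_gt0 (u : X -> R) x : u x != 0 -> 0 < l2 G u u.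
Proof.
move=> ux; rewrite lt_neqAle l2_ge0 andbT eq_sym.
by apply: contra ux => /eqP /l2_eq0 ->.
Qed.

Definition linear_closed (V : (X -> R) -> Prop) :=
  forall a u v, V u -> V v -> V (fun x => a * u x + v x).

(** The coefficients and functions are indexed by nat, to serve families that
    grow by one member at a time. *)
Lemma linear_closed_sum V n (a : nat -> R) (f : nat -> X -> R) (u : X -> R) :
  linear_closed V -> V u -> (forall j, (j < n)%N -> V (f j)) ->
  V (fun x => u x + \sum_(j < n) a j * f j x).
Proof.
move=> Vlin Vu; elim: n => [|n IH] Vf.
  by apply: pred_eqfun Vu => x; rewrite big_ord0 addr0.
have /(_ (fun j jn => Vf j (ltnW jn))) := IH.
move=> /(Vlin (a n) _ _ (Vf n (ltnSn n))).
by apply: pred_eqfun => x; rewrite big_ord_recr/=; ring.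
Qed.

(* complex -> real eigenvectors *)
(** For a complex eigenvector a + ib with eigenvalue al + i be, comparing <Ha, b>
    with <a, Hb> gives be (|a|^2 + |b|^2) = 0, so the eigenvalue is real and the
    real and imaginary parts are themselves eigenvectors. *)
Lemma real_eigenfunction_of_complex (al be : R) (a b : X -> R) :
  (forall x, H a x = al * a x - be * b x) ->
  (forall x, H b x = be * a x + al * b x) ->
  (exists x, (a x != 0) || (b x != 0)) ->
  (forall x, H a x = al * a x) /\ (forall x, H b x = al * b x).
Proof.
move=> Ha Hb [x0 nz].
have := schrodinger_selfadjoint G q idfun a b.
have -> : H a = fun x => al * a x + (- be * b x).
  by apply/funext => x; rewrite Ha mulNr.
have -> : H b = fun x => be * a x + al * b x by exact/funext.
rewrite dot_lin [RHS]dotC dot_lin.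
have sc c (u v : X -> R) : dot G idfun (fun x => c * u x) v = c * dot G idfun u v.
  by rewrite /dot mulr_sumr; apply: eq_bigr => x _ /=; ring.
rewrite !sc (dotC _ _ b a) [RHS]addrC => /addrI e.
have {}e : be * (l2 G a a + l2 G b b) = 0.
  by move: e; rewrite /l2 /dot/= => e; lra.
have be0 : be = 0.
  apply/eqP; move/eqP: e; rewrite mulf_eq0 => /orP[//|].
  rewrite gt_eqF//; case/orP: nz => /l2_gt0 ?.
    by rewrite ltr_wpDr// l2_ge0.
  by rewrite ltr_wpDl// l2_ge0.
by split=> x; rewrite ?Ha ?Hb be0; ring.
Qed.

(** The subspace W is only a predicate, so there is no matrix of H restricted to
    W. Instead, the characteristic polynomial of H splits over the complex
    numbers and kills a nonzero w in W, so that applying its linear factors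
    H - z to w one after the other must at some step turn a nonzero vector into
    0. That vector is a complex eigenvector with real and imaginary parts in W,
    and [real_eigenfunction_of_complex] applies. *)
Lemma eigenfunction_in_invariant (W : (X -> R) -> Prop) :
  linear_closed W -> (forall u, W u -> W (H u)) ->
  (exists u x, W u /\ u x != 0) ->
  exists lam u, W u /\ eigenfunction G q lam u.
Proof.
move=> Wlin WH [w [x0 [Ww wx0]]].
have W0 : W (fun=> 0).
  by apply: pred_eqfun (Wlin (-1) _ _ Ww Ww) => x; rewrite mulN1r addNr.
have [n Xn] : exists n, #|X| = n.+1.
  by case E : #|X| => [|n]; [case: (fintype0 x0 E)|exists n].
(* Matrices form a ring, with Cayley-Hamilton, at sizes of the form n.+1 only;
   r and e identify X with 'I_n.+1. *)
pose r (x : X) : 'I_n.+1 := cast_ord Xn (enum_rank x).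
pose e (i : 'I_n.+1) : X := enum_val (cast_ord (esym Xn) i).
have re : cancel e r by move=> i; rewrite /r /e enum_valK cast_ordKV.
have er : cancel r e by move=> x; rewrite /r /e cast_ordK enum_rankK.
pose A : 'M[R[i]]_n.+1 := \matrix_(i, j) (kernel G q (e i) (e j))%:C%C.
(* C v: both parts of the complex vector v lie in W. *)
pose C := fun v : 'cV[R[i]]_n.+1 =>
  W (fun x => complex.Re (v (r x) 0)) /\ W (fun x => complex.Im (v (r x) 0)).
have AE (v : 'cV_n.+1) x :
    (A *m v) (r x) 0 = \sum_y (kernel G q x y)%:C%C * v (r y) 0.
  by rewrite mxE (reindex r) /=; [apply: eq_bigr => y _; rewrite !mxE !er|exists e => i _].
have ReA (v : 'cV_n.+1) x : complex.Re ((A *m v) (r x) 0) =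
    H (fun y => complex.Re (v (r y) 0)) x.
  rewrite AE raddf_sum; apply: eq_bigr => y _ /=.
  by case: (v _ _) => a b /=; rewrite mul0r subr0.
have ImA (v : 'cV_n.+1) x : complex.Im ((A *m v) (r x) 0) =
    H (fun y => complex.Im (v (r y) 0)) x.
  rewrite AE raddf_sum; apply: eq_bigr => y _ /=.
  by case: (v _ _) => a b /=; rewrite mul0r addr0.
have key : forall (s : seq R[i]) v, C v -> v != 0 ->
    horner_mx A (\prod_(z <- s) ('X - z%:P)) *m v = 0 ->
    exists z u, [/\ C u, u != 0 & A *m u = z *: u].
  elim=> [|z s IH] v Cv v0.
    by rewrite big_nil rmorph1 mul1mx => /eqP; rewrite (negPf v0).
  rewrite big_cons mulrC rmorphM -mulmxA => ann.
  have [u0|u0] := eqVneq (horner_mx A ('X - z%:P) *m v) 0.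
    exists z, v; split=> //; apply/eqP; rewrite -subr_eq0 -u0.
    by rewrite rmorphB/= horner_mx_X horner_mx_C mulmxBl mul_scalar_mx.
  apply: IH u0 ann; rewrite rmorphB/= horner_mx_X horner_mx_C mulmxBl mul_scalar_mx.
  case: Cv => Wr Wi; case: z {s} => a b; split.
    have := Wlin (-a) _ _ Wr (Wlin b _ _ Wi (WH _ Wr)).
    apply: pred_eqfun => x; rewrite !mxE raddfB /= -ReA mxE.
    by case: (v _ _) => c d /=; ring.
  have := Wlin (-a) _ _ Wi (Wlin (-b) _ _ Wr (WH _ Wi)).
  apply: pred_eqfun => x; rewrite !mxE raddfB /= -ImA mxE.
  by case: (v _ _) => c d /=; ring.
have [s sE] := closed_field_poly_normal (char_poly A).
pose v : 'cV[R[i]]_n.+1 := \col_i (w (e i))%:C%C.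
have [] := key s v.
- split; last by apply: pred_eqfun W0 => x; rewrite mxE.
  by apply: pred_eqfun Ww => x; rewrite mxE er.
- apply/eqP => /matrixP/(_ (r x0) 0); rewrite !mxE er => -[w0].
  by rewrite w0 eqxx in wx0.
- have := Cayley_Hamilton A; rewrite sE (monicP (char_poly_monic A)) scale1r => ->.
  by rewrite mul0mx.
move=> z [u [[Wr Wi] u0 Au]].
pose a x := complex.Re (u (r x) 0); pose b x := complex.Im (u (r x) 0).
have nz : exists x, (a x != 0) || (b x != 0).
  apply: contrapT => nx; move/eqP: u0; apply; apply/matrixP => i j; rewrite ord1 mxE.
  have ab0 x : a x = 0 /\ b x = 0.
    by split; apply/eqP; apply: contrapT => /negP h; apply: nx; exists x; rewrite h ?orbT.
  have := ab0 (e i); rewrite /a /b re; case: (u i 0) => /= ? ? [-> ->] //.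
have [] := @real_eigenfunction_of_complex (complex.Re z) (complex.Im z) a b _ _ nz.
- by move=> x; rewrite -ReA Au mxE /a /b; case: (z); case: (u _ _).
- move=> x; rewrite -ImA Au mxE /a /b.
  by case: (z); case: (u _ _) => ? ? ? ? /=; rewrite addrC.
move=> Ha Hb; case: nz => x /orP[ax|bx].
  by exists (complex.Re z), a; split=> //; split; [exists x|exact/eigen_eqP].
by exists (complex.Re z), b; split=> //; split; [exists x|exact/eigen_eqP].
Qed.

End Spectral.

(** * Orthonormal eigenbases inside invariant subspaces *)

Section Eigenbasis.
Context (R : realType) (X : finType) (G : wgraph R X) (q : X -> R).
Local Notation H := (real_schrodinger G q).

Lemma l2_sum_enum (u v : X -> R) :
  l2 G u v = \sum_(i < #|X|) mu G (enum_val i) * u (enum_val i) * v (enum_val i).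
Proof. by rewrite /l2 (reindex _ (onW_bij _ (@enum_val_bij X))). Qed.

Lemma l2C (u v : X -> R) : l2 G u v = l2 G v u.
Proof. exact: (dotC G idfun). Qed.

Lemma l2_lin a (u v w : X -> R) :
  l2 G (fun x => a * u x + v x) w = a * l2 G u w + l2 G v w.
Proof. exact: (dot_lin G idfun). Qed.

Lemma l2_indicator (u : X -> R) c : l2 G u (indicator c) = mu G c * u c.
Proof. exact: (dot_indicator G idfun). Qed.

Lemma l2_sum n (a : 'I_n -> R) (f : 'I_n -> X -> R) (w : X -> R) :
  l2 G (fun x => \sum_j a j * f j x) w = \sum_j a j * l2 G (f j) w.
Proof.
rewrite /l2.
under eq_bigr => x _ do rewrite mulr_sumr mulr_suml.
rewrite exchange_big /=; apply: eq_bigr => j _.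
by rewrite mulr_sumr; apply: eq_bigr => x _; ring.
Qed.

Definition orthonormal n (phi : 'I_n -> X -> R) :=
  forall j k, l2 G (phi j) (phi k) = (j == k)%:R.

Lemma orthonormal_mx n (phi : 'I_n -> X -> R) : orthonormal phi ->
  (\matrix_(j < n, i < #|X|) phi j (enum_val i)) *m
  (\matrix_(i < #|X|, j < n) (mu G (enum_val i) * phi j (enum_val i))) = 1%:M.
Proof.
move=> on; apply/matrixP => j k; rewrite !mxE -on l2_sum_enum.
by apply: eq_bigr => i _; rewrite !mxE; ring.
Qed.

(** An orthonormal family gives a matrix with a right inverse, which bounds the
    number of its rows. *)
Lemma orthonormal_leq n (phi : 'I_n -> X -> R) : orthonormal phi -> (n <= #|X|)%N.
Proof. by move/orthonormal_mx/mulmx1_min. Qed.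

(** When the matrix of [orthonormal_mx] is square, its right inverse is also a
    left inverse. *)
Lemma orthonormal_resolution n (phi : 'I_n -> X -> R) :
  n = #|X| -> orthonormal phi ->
  forall x y, \sum_j phi j x * (mu G y * phi j y) = (x == y)%:R.
Proof.
move=> nX; subst n => /orthonormal_mx/mulmx1C/matrixP on x y.
have := on (enum_rank y) (enum_rank x); rewrite !mxE (inj_eq enum_rank_inj) eq_sym => <-.
by apply: eq_bigr => j _; rewrite !mxE !enum_rankK mulrC.
Qed.

Lemma orthonormal_spanning n (phi : 'I_n -> X -> R) :
  n = #|X| -> orthonormal phi ->
  forall u : X -> R, exists c : 'I_n -> R, forall x, u x = \sum_j c j * phi j x.
Proof.
move=> nX on u; exists (fun j => l2 G u (phi j)) => x.
rewrite /l2; under eq_bigr => j _ do rewrite mulr_suml.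
rewrite exchange_big /=.
transitivity (\sum_y u y * (x == y)%:R).
  rewrite (bigD1 x)//= eqxx mulr1 big1 ?addr0// => y.
  by rewrite eq_sym => /negPf->; rewrite mulr0.
apply: eq_bigr => y _; rewrite -(orthonormal_resolution nX on) mulr_sumr.
by apply: eq_bigr => j _; ring.
Qed.

(** The matrix of the m linear conditions has more rows than columns, hence a
    nonzero vector in its row kernel. *)
Lemma exists_orthogonal m (phi : nat -> X -> R) : (m < #|X|)%N ->
  exists u x, u x != 0 /\ forall j, (j < m)%N -> l2 G u (phi j) = 0.
Proof.
move=> mX.
pose A : 'M[R]_(#|X|, m) := \matrix_(i, j) (mu G (enum_val i) * phi j (enum_val i)).
have : kermx A != 0.
  by rewrite kermx_eq0 /row_free neq_ltn (leq_ltn_trans (rank_leq_col A) mX).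
move=> /rowV0Pn[v /sub_kermxP vA v0].
exists (fun x => v 0 (enum_rank x)).
have [i vi] : exists i, v 0 i != 0.
  apply: contrapT => nv; move/eqP: v0; apply; apply/rowP => i; rewrite mxE.
  by apply/eqP; apply: contrapT => /negP h; apply: nv; exists i.
exists (enum_val i); rewrite enum_valK; split=> // j jm.
have /matrixP/(_ 0 (Ordinal jm)) := vA; rewrite !mxE => vAj.
rewrite l2_sum_enum -[RHS]vAj.
by apply: eq_bigr => k _; rewrite !mxE enum_valK /=; ring.
Qed.

Lemma eigenfunction_orthogonal_invariant lam (phi u : X -> R) :
  eigen_eq G q lam phi -> l2 G u phi = 0 -> l2 G (H u) phi = 0.
Proof.
move=> /eigen_eqP e u0.
rewrite [LHS](schrodinger_selfadjoint G q idfun).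
transitivity (lam * l2 G u phi); last by rewrite u0 mulr0.
rewrite /dot /l2 mulr_sumr; apply: eq_bigr => x _ /=; rewrite e; ring.
Qed.

(** The hypothesis [Vfull] says that no eigenfunction is orthogonal to V. It holds
    when V is everything, which gives the spectral theorem, and when V is spanned
    by the functions H^k 1_b with b in an observable set. *)
Section InsideInvariantSubspace.
Context (V : (X -> R) -> Prop) (Vlin : linear_closed V).
Hypothesis VH : forall u, V u -> V (H u).
Hypothesis Vfull : forall lam u, eigenfunction G q lam u ->
  exists2 v, V v & l2 G u v != 0.

(** The orthogonal complement of the family is invariant and nonzero, so it
    contains an eigenfunction psi. Some v in V has <psi, v> <> 0; projecting v away
    from the family does not change this product, so V meets the complement in
    a nonzero vector, and the invariant subspace V /\ complement contains the
    next eigenfunction. *)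
Lemma orthonormal_eigenfunctions_extend m (lam : nat -> R) (phi : nat -> X -> R) :
  (m < #|X|)%N ->
  (forall j, (j < m)%N -> eigenfunction G q (lam j) (phi j) /\ V (phi j)) ->
  (forall j k, (j < m)%N -> (k < m)%N -> l2 G (phi j) (phi k) = (j == k)%:R) ->
  exists l u, [/\ eigenfunction G q l u, V u, l2 G u u = 1 &
    forall j, (j < m)%N -> l2 G u (phi j) = 0].
Proof.
move=> mX eig on.
pose P u := forall j, (j < m)%N -> l2 G u (phi j) = 0.
have Plin : linear_closed P.
  by move=> a u v Pu Pv j jm; rewrite l2_lin Pu// Pv// mulr0 addr0.
have PH u : P u -> P (H u).
  move=> Pu j jm; have [[_ e] _] := eig j jm.
  by apply: eigenfunction_orthogonal_invariant e _; exact: Pu.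
have [w0 [x0 [w0x Pw0]]] := exists_orthogonal phi mX.
have [] := @eigenfunction_in_invariant _ _ G q P Plin PH.
  by exists w0, x0.
move=> l0 [psi [Ppsi psieig]].
have [v Vv psiv] := Vfull psieig.
(* The projection of v away from the family. *)
pose w x := v x + \sum_(j < m) (- l2 G v (phi j)) * phi j x.
have Vw : V w.
  apply: (@linear_closed_sum _ _ V m (fun j => - l2 G v (phi j)) phi v) => // j jm.
  by have [] := eig j jm.
have wE (u : X -> R) :
    l2 G w u = l2 G v u + \sum_(j < m) - l2 G v (phi j) * l2 G (phi j) u.
  rewrite -(l2_sum (fun j : 'I_m => - l2 G v (phi j)) (fun j : 'I_m => phi j)).
  rewrite -(mul1r (l2 G v u)) -l2_lin.
  by apply: eq_bigr => x _; rewrite mul1r.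
have Pw : P w.
  move=> j jm; rewrite wE (bigD1 (Ordinal jm))//= on// eqxx big1 => [|k kj].
    by rewrite mulr1 addr0 addrN.
  by rewrite on// [k == j :> nat](negPf kj) mulr0.
have wpsi : l2 G w psi != 0.
  rewrite wE big1 ?addr0; first by rewrite l2C.
  by move=> j _; rewrite (l2C _ psi) Ppsi ?mulr0.
have [x wx] : exists x, w x != 0.
  apply: contrapT => nw; move/eqP: wpsi; apply; apply: big1 => x _.
  suff -> : w x = 0 by rewrite mulr0 mul0r.
  by apply/eqP; apply: contrapT => /negP h; apply: nw; exists x.
have [] := @eigenfunction_in_invariant _ _ G q (fun u => P u /\ V u).
- by move=> a u u' [? ?] [? ?]; split; [exact: Plin|exact: Vlin].
- by move=> u [? ?]; split; [exact: PH|exact: VH].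
- by exists w, x.
move=> l [u [[Pu Vu] [[y uy] /eigen_eqP ue]]].
have nu := l2_gt0 G uy.
pose c := (Num.sqrt (l2 G u u))^-1.
have c0 : c != 0 by rewrite invr_eq0 gt_eqF// sqrtr_gt0.
have l2c (z : X -> R) : l2 G (fun x => c * u x) z = c * l2 G u z.
  by rewrite /l2 mulr_sumr; apply: eq_bigr => t _; ring.
exists l, (fun x => c * u x); split.
- split; first by exists y; rewrite mulf_neq0.
  apply/eigen_eqP => t; rewrite mulrCA -ue /schrodinger mulr_sumr.
  by apply: eq_bigr => s _; ring.
- apply: pred_eqfun (Vlin (c - 1) Vu Vu) => t; ring.
- rewrite l2c l2C l2c mulrA -expr2 exprVn sqr_sqrtr ?ltW// mulVf// gt_eqF//.
- by move=> j jm; rewrite l2c Pu// mulr0.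
Qed.

Lemma orthonormal_eigenbasis_inside :
  exists (lam : 'I_#|X| -> R) (phi : 'I_#|X| -> X -> R),
    orthonormal_eigenbasis G q lam phi /\ forall j, V (phi j).
Proof.
have : forall m, (m <= #|X|)%N -> exists (lam : nat -> R) (phi : nat -> X -> R),
  (forall j, (j < m)%N -> eigenfunction G q (lam j) (phi j) /\ V (phi j)) /\
  (forall j k, (j < m)%N -> (k < m)%N -> l2 G (phi j) (phi k) = (j == k)%:R).
  elim=> [_|m IH mX]; first by exists (fun=> 0), (fun _ _ => 0).
  have [lam [phi [eig on]]] := IH (ltnW mX).
  have [l [u [ue Vu uu up]]] := orthonormal_eigenfunctions_extend mX eig on.
  exists (fun j => if j == m then l else lam j), (fun j => if j == m then u else phi j).
  split=> [j|j k]; rewrite !ltnS (leq_eqVlt j).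
    by case: eqP => //= _ /eig.
  rewrite (leq_eqVlt k).
  have [->|jm]/= := eqVneq j m; have [->|km]/= := eqVneq k m => //.
  - by move=> _ km'; rewrite up// eq_sym (negPf km).
  - by move=> jm' _; rewrite l2C up// (negPf jm).
  - exact: on.
move=> /(_ _ (leqnn _))[lam [phi [eig on]]].
exists (fun j => lam j), (fun j => phi j).
have on' : orthonormal (fun j : 'I_#|X| => phi j) by move=> j k; exact: on.
split=> [|j]; last by have [] := eig j (ltn_ord j).
split=> // [j|]; first by have [] := eig j (ltn_ord j).
exact: orthonormal_spanning.
Qed.

End InsideInvariantSubspace.

Lemma spectral_theorem :
  exists (lam : 'I_#|X| -> R) (phi : 'I_#|X| -> X -> R),
    orthonormal_eigenbasis G q lam phi.
Proof.
have [] := @orthonormal_eigenbasis_inside (fun=> True) => //.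
  by move=> lam u [[x ux] _]; exists u => //; rewrite gt_eqF// (l2_gt0 G ux).
by move=> lam [phi [basis _]]; exists lam, phi.
Qed.

End Eigenbasis.

(** * Reconstruction of the spectral data from the moments *)

Section Twin.
Context (R : realType) (X X' : finType) (G : wgraph R X) (G' : wgraph R X').
Context (q : X -> R) (q' : X' -> R).
Context (I : Type) (beta : I -> X) (beta' : I -> X').
Local Notation H := (real_schrodinger G q).
Local Notation H' := (real_schrodinger G' q').

Definition moments_agree := forall k b c,
  iter k H (indicator (beta c)) (beta b) = iter k H' (indicator (beta' c)) (beta' b).

(** The linear span of the pairs (H^k 1_c, H'^k 1_c'). It is introduced as a
    relation, because it is the moment hypothesis that makes it a function; as
    an inductive predicate it comes with the induction on how a pair is built. *)
Inductive twin : (X -> R) -> (X' -> R) -> Prop :=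
| twin_indicator c : twin (indicator (beta c)) (indicator (beta' c))
| twin_lin a u u' v v' : twin u u' -> twin v v' ->
    twin (fun x => a * u x + v x) (fun x => a * u' x + v' x)
| twin_schrodinger u u' : twin u u' -> twin (H u) (H' u').

Hypothesis mu_eq : forall b, mu G (beta b) = mu G' (beta' b).
Hypothesis moments : moments_agree.

(** The values after applying H any number of times have to be compared together,
    since the induction passes from u to H u. *)
Lemma twin_eq_on u u' : twin u u' -> forall b, u (beta b) = u' (beta' b).
Proof.
move=> tw b; suff: forall k, iter k H u (beta b) = iter k H' u' (beta' b).
  by move/(_ 0%N).
elim: tw => {u u'} [c k|a u u' v v' _ IHu _ IHv k|u u' _ IHu k].
- exact: moments.
- by rewrite !iter_schrodinger_lin IHu IHv.
- by rewrite -!iterSr.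
Qed.

(** By self-adjointness the powers of H building v can be moved over to u, which
    leaves products with indicators, that is, values at observed vertices. *)
Lemma twin_isometry u u' v v' : twin u u' -> twin v v' -> l2 G u v = l2 G' u' v'.
Proof.
move=> tu tv; elim: tv u u' tu => {v v'} [c|a v v' w w' _ IHv _ IHw|v v' _ IHv] u u' tu.
- by rewrite !l2_indicator mu_eq (twin_eq_on tu).
- rewrite l2C l2_lin [RHS]l2C l2_lin (l2C G v) (l2C G w) (l2C G' v') (l2C G' w').
  by rewrite (IHv _ _ tu) (IHw _ _ tu).
- rewrite -[LHS](schrodinger_selfadjoint G q idfun).
  rewrite -[RHS](schrodinger_selfadjoint G' q' idfun).
  exact/IHv/twin_schrodinger.
Qed.

(** The defect H u - lam u and its partner have the same norm. *)
Lemma twin_eigen_eq lam u u' : twin u u' -> eigen_eq G q lam u -> eigen_eq G' q' lam u'.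
Proof.
move=> tu /eigen_eqP e; apply/eigen_eqP => x.
pose w z := (- lam) * u z + H u z; pose w' z := (- lam) * u' z + H' u' z.
have tw : twin w w' by apply: twin_lin => //; exact: twin_schrodinger.
have : l2 G' w' w' = 0.
  rewrite -(twin_isometry tw tw); apply: big1 => z _.
  by rewrite /w e mulNr addNr mulr0.
by move=> /l2_eq0/(_ x); rewrite /w' mulNr addrC => /subr0_eq.
Qed.

Hypothesis observable : forall lam u, eigenfunction G q lam u ->
  exists b, u (beta b) != 0.

(** An eigenfunction does not vanish at some beta b, so it is not orthogonal to
    the indicator of beta b, which has a partner. *)
Lemma twin_eigenbasis : exists (lam : 'I_#|X| -> R) (phi : 'I_#|X| -> X -> R)
    (phi' : 'I_#|X| -> X' -> R),
  orthonormal_eigenbasis G q lam phi /\ forall j, twin (phi j) (phi' j).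
Proof.
have [|||lam [phi [basis tw]]] :=
    @orthonormal_eigenbasis_inside _ _ G q (fun u => exists u', twin u u').
- by move=> a u v [u' tu] [v' tv]; eexists; exact: (twin_lin a tu tv).
- by move=> u [u' tu]; eexists; exact: (twin_schrodinger tu).
- move=> lam u /observable[b ub].
  exists (indicator (beta b)); first by exists (indicator (beta' b)); exact: twin_indicator.
  by rewrite l2_indicator mulf_neq0// gt_eqF ?mu_gt0.
have [phi' tw'] := choice tw.
by exists lam, phi, phi'.
Qed.

End Twin.

Section Reconstruction.
Context (R : realType) (X X' : finType) (G : wgraph R X) (G' : wgraph R X').
Context (q : X -> R) (q' : X' -> R) (B : {set X}) (B' : {set X'}).
Context (Phi0 : {x | x \in B} -> {x | x \in B'}).
Local Notation beta' := (fun b => val (Phi0 b)).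

(** The partners of an eigenbasis of X form an orthonormal family on X', whence
    |X| <= |X'|; the same argument from X' to X gives equality, so the partners
    span. *)
Lemma moments_to_spectral_data :
  no_vanishing_eigenfunction G q B ->
  no_vanishing_eigenfunction G' q' B' ->
  bijective Phi0 ->
  (forall b, mu G' (val (Phi0 b)) = mu G (val b)) ->
  moments_agree G G' q q' val beta' ->
  spectral_data_coincide G G' q q' Phi0.
Proof.
move=> nv nv' [Psi0 PhiK PsiK] mu_eq mom.
have mom' : moments_agree G' G q' q beta' val by move=> k b c; rewrite mom.
have mu_eq' b : mu G (val b) = mu G' (val (Phi0 b)) by rewrite mu_eq.
have obs lam u : eigenfunction G q lam u -> exists b : {x | x \in B}, u (val b) != 0.
  move=> e; apply: contrapT => no; apply: nv; exists lam, u; split=> // x xB.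
  by apply/eqP; apply: contrapT => /negP ux; apply: no; exists (exist _ x xB).
have obs' lam u : eigenfunction G' q' lam u -> exists b, u (val (Phi0 b)) != 0.
  move=> e; apply: contrapT => no; apply: nv'; exists lam, u; split=> // x xB.
  apply/eqP; apply: contrapT => /negP ux; apply: no.
  by exists (Psi0 (exist _ x xB)); rewrite PsiK.
have [lam [phi [phi' [[_ eig on span] tw]]]] :=
  @twin_eigenbasis _ _ _ G G' q q' _ val beta' obs.
have on' : orthonormal G' phi'.
  by move=> j k; rewrite -(twin_isometry mu_eq' mom (tw j) (tw k)).
have card_eq : #|X| = #|X'|.
  apply/eqP; rewrite eqn_leq (orthonormal_leq on')/=.
  have [lam2 [psi' [psi [[_ _ on2 _] tw2]]]] :=
    @twin_eigenbasis _ _ _ G' G q' q _ beta' val obs'.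
  suff /orthonormal_leq : orthonormal G psi by [].
  by move=> j k; rewrite -(twin_isometry mu_eq mom' (tw2 j) (tw2 k)).
exists #|X|, lam, phi, phi'; split=> //.
  split=> //; last exact: orthonormal_spanning.
  move=> j; split; last by have [_ e] := eig j; exact: (twin_eigen_eq mu_eq' mom (tw j) e).
  apply: contrapT => no; have := on' j j; rewrite eqxx => /eqP; rewrite eq_sym.
  rewrite [l2 _ _ _]big1 ?oner_eq0// => x _.
  suff -> : phi' j x = 0 by rewrite mulr0.
  by apply/eqP; apply: contrapT => /negP h; apply: no; exists x.
by move=> j b; exact: (twin_eq_on mom (tw j)).
Qed.

End Reconstruction.

(** * Linear evolutions with an abstract time derivative *)

(** The properties of a time derivative D u t l (read: u has derivative l at time
    t) shared by the three equations. Functions of time only matter on the times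
    in [dom], and t0 is the initial time; D may absorb a scalar, as in i d/dt.
    Well-posedness is only demanded of scalar equations D c + lam c = F: uniqueness
    for F = 0 and existence for F = 1. The coefficients along an eigenbasis reduce
    the equation on the graph to those. *)
Record evolution_law (R : realType) (K : comNzRingType)
    (iota : {rmorphism R -> K}) (T : Type) (dom : T -> Prop) (t0 : T)
    (D : (T -> K) -> T -> K -> Prop) : Prop := EvolutionLaw {
  law_start : dom t0;
  law_zero : forall t, dom t -> D (fun=> 0) t 0;
  law_linear : forall a u v t l m, dom t -> D u t l -> D v t m ->
    D (fun s => a * u s + v s) t (a * l + m);
  law_unique : forall u v t l m, dom t -> (forall s, dom s -> u s = v s) ->
    D u t l -> D v t m -> l = m;
  law_mode_unique : forall lam c, c t0 = 0 ->
    (forall t, dom t -> D c t (- (iota lam * c t))) ->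
    forall t, dom t -> c t = 0;
  law_mode_exists : forall lam, exists c, c t0 = 0 /\
    forall t, dom t -> D c t (1 - iota lam * c t) }.

Section Evolution.
Context (R : realType) (K : comNzRingType) (iota : {rmorphism R -> K}).
Context (T : Type) (dom : T -> Prop) (t0 : T) (D : (T -> K) -> T -> K -> Prop).
Hypothesis law : evolution_law iota dom t0 D.

Lemma law_sum (I : finType) (a : I -> K) (u : I -> T -> K) (l : I -> K) t :
  dom t -> (forall i, D (u i) t (l i)) ->
  D (fun s => \sum_i a i * u i s) t (\sum_i a i * l i).
Proof.
move=> dt Du; elim: (index_enum I) => [|i r IH].
  rewrite big_nil; suff -> : (fun s => \sum_(i <- [::]) a i * u i s) = fun=> 0.
    exact: law_zero law _ dt.
  by apply/funext => s; rewrite big_nil.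
rewrite big_cons.
suff -> : (fun s => \sum_(i <- i :: r) a i * u i s) =
    fun s => a i * u i s + \sum_(i <- r) a i * u i s.
  by apply: (law_linear law).
by apply/funext => s; rewrite big_cons.
Qed.

Section OneGraph.
Context (X : finType) (G : wgraph R X) (q : X -> R).
Local Notation H := (schrodinger G q iota).

Definition solves (f Phi : X -> T -> K) : Prop :=
  (forall x, Phi x t0 = 0) /\
  (forall x t, dom t -> exists2 l, D (Phi x) t l & l + H (Phi^~ t) x = f x t).

Definition mode (phi : X -> R) (u : X -> K) : K := dot G iota u (iota \o phi).

Context (n : nat) (lam : 'I_n -> R) (phi : 'I_n -> X -> R).
Hypothesis basis : orthonormal_eigenbasis G q lam phi.

(** Along an eigenbasis the operator is diagonal, by self-adjointness. *)
Lemma mode_schrodinger j u : mode (phi j) (H u) = iota (lam j) * mode (phi j) u.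
Proof.
have [_ /(_ j)[_ /eigen_eqP e] _ _] := basis.
rewrite /mode schrodinger_selfadjoint /dot mulr_sumr; apply: eq_bigr => x _.
have -> : H (iota \o phi j) x = iota (lam j * phi j x).
  by rewrite -e rmorph_sum; apply: eq_bigr => y _; rewrite rmorphM.
by rewrite rmorphM /=; ring.
Qed.

Lemma mode_lin j a (u v : X -> K) :
  mode (phi j) (fun x => a * u x + v x) = a * mode (phi j) u + mode (phi j) v.
Proof. exact: dot_lin. Qed.

(** Real eigenbases also expand functions with values in K, because the
    completeness relation is an identity between real numbers. *)
Lemma mode_expansion (u : X -> K) x : u x = \sum_j mode (phi j) u * iota (phi j x).
Proof.
have [nX _ on _] := basis.
rewrite /mode /dot; under eq_bigr => j _ do rewrite mulr_suml.
rewrite exchange_big /=.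
transitivity (\sum_y u y * (x == y)%:R).
  rewrite (bigD1 x)//= eqxx mulr1 big1 ?addr0// => y.
  by rewrite eq_sym => /negPf->; rewrite mulr0.
apply: eq_bigr => y _.
rewrite -(rmorph_nat iota) -(orthonormal_resolution nX on) rmorph_sum mulr_sumr.
by apply: eq_bigr => j _; rewrite !rmorphM /=; ring.
Qed.

Lemma mode_synthesis j (c : 'I_n -> K) :
  mode (phi j) (fun x => \sum_k c k * iota (phi k x)) = c j.
Proof.
have [_ _ on _] := basis.
rewrite /mode /dot.
under eq_bigr => x _ do rewrite mulr_sumr mulr_suml.
rewrite exchange_big /=.
transitivity (\sum_k c k * iota (l2 G (phi k) (phi j))).
  apply: eq_bigr => k _; rewrite rmorph_sum mulr_sumr; apply: eq_bigr => x _.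
  by rewrite !rmorphM /=; ring.
rewrite (bigD1 j)//= on eqxx rmorph1 mulr1 big1 ?addr0// => k kj.
by rewrite on (negPf kj) rmorph0 mulr0.
Qed.

Lemma law_mode j (Phi : X -> T -> K) (l : X -> K) t : dom t ->
  (forall x, D (Phi x) t (l x)) ->
  D (fun s => mode (phi j) (Phi^~ s)) t (mode (phi j) l).
Proof.
move=> dt DPhi; pose a x := iota (mu G x) * iota (phi j x).
have E u : mode (phi j) u = \sum_x a x * u x.
  by apply: eq_bigr => x _; rewrite mulrAC.
rewrite E; have -> : (fun s => mode (phi j) (Phi^~ s)) = fun s => \sum_x a x * Phi x s.
  by apply/funext => s; exact: E.
exact: law_sum.
Qed.

Lemma solution_modes f Phi : solves f Phi -> forall j,
  mode (phi j) (Phi^~ t0) = 0 /\ forall t, dom t ->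
  D (fun s => mode (phi j) (Phi^~ s)) t
    (mode (phi j) (f^~ t) - iota (lam j) * mode (phi j) (Phi^~ t)).
Proof.
move=> [Phi0 DPhi] j; split=> [|t dt].
  by rewrite /mode /dot big1// => x _; rewrite Phi0 mulr0 mul0r.
have -> : mode (phi j) (f^~ t) - iota (lam j) * mode (phi j) (Phi^~ t) =
    mode (phi j) (fun x => f x t - H (Phi^~ t) x).
  rewrite -mode_schrodinger.
  have -> : (fun x => f x t - H (Phi^~ t) x) =
      fun x => (-1) * H (Phi^~ t) x + f x t.
    by apply/funext => x; rewrite mulN1r addrC.
  by rewrite mode_lin mulN1r addrC.
apply: law_mode => // x; have [l Dl <-] := DPhi x t dt.
by rewrite addrK.
Qed.

Lemma solution_of_modes f (c : 'I_n -> T -> K) :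
  (forall j, c j t0 = 0 /\ forall t, dom t ->
     D (c j) t (mode (phi j) (f^~ t) - iota (lam j) * c j t)) ->
  solves f (fun x t => \sum_j c j t * iota (phi j x)).
Proof.
move=> cP; split=> [x|x t dt].
  by rewrite big1// => j _; have [-> _] := cP j; rewrite mul0r.
exists (\sum_j iota (phi j x) * (mode (phi j) (f^~ t) - iota (lam j) * c j t)).
  have -> : (fun t => \sum_j c j t * iota (phi j x)) =
      fun t => \sum_j iota (phi j x) * c j t.
    by apply/funext => s; apply: eq_bigr => j _; rewrite mulrC.
  by apply: law_sum => // j; exact: (cP j).2.
pose Phi x s := \sum_j c j s * iota (phi j x).
rewrite [X in _ + X](mode_expansion (H (Phi^~ t)) x) -big_split/=.
rewrite [RHS](mode_expansion (f^~ t) x).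
apply: eq_bigr => j _; rewrite mode_schrodinger mode_synthesis; ring.
Qed.

Lemma solution_unique f Phi Psi : solves f Phi -> solves f Psi ->
  forall x t, dom t -> Phi x t = Psi x t.
Proof.
move=> sPhi sPsi x t dt.
rewrite [LHS](mode_expansion (Phi^~ t)) [RHS](mode_expansion (Psi^~ t)).
apply: eq_bigr => j _; congr (_ * _).
have [P0 DP] := solution_modes sPhi j; have [Q0 DQ] := solution_modes sPsi j.
pose c s := (-1) * mode (phi j) (Psi^~ s) + mode (phi j) (Phi^~ s).
suff : c t = 0 by rewrite /c mulN1r addrC => /subr0_eq.
apply: (law_mode_unique law (lam := lam j)) (dt) => [|s ds].
  by rewrite /c P0 Q0 mulr0 addr0.
rewrite (_ : - _ = (-1) * (mode (phi j) (f^~ s) - iota (lam j) * mode (phi j) (Psi^~ s))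
  + (mode (phi j) (f^~ s) - iota (lam j) * mode (phi j) (Phi^~ s))).
  exact: (law_linear law (-1) ds (DQ s ds) (DP s ds)).
by rewrite /c; ring.
Qed.

Lemma constant_source_solvable (g : X -> K) : exists Phi, solves (fun x _ => g x) Phi.
Proof.
have [c cP] := choice (fun j => law_mode_exists law (lam j)).
exists (fun x t => \sum_j (mode (phi j) g * c j t) * iota (phi j x)).
apply: (@solution_of_modes _ (fun j t => mode (phi j) g * c j t)) => j.
have [c0 Dc] := cP j; split=> [|t dt]; first by rewrite c0 mulr0.
rewrite (_ : (fun t => _) = fun s => mode (phi j) g * c j s + 0); last first.
  by apply/funext => s; rewrite addr0.
rewrite (_ : _ - _ = mode (phi j) g * (1 - iota (lam j) * c j t) + 0); last by ring.
exact: (law_linear law _ dt (Dc t dt) (law_zero law dt)).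
Qed.

End OneGraph.

Section TwoGraphs.
Context (X X' : finType) (G : wgraph R X) (G' : wgraph R X').
Context (q : X -> R) (q' : X' -> R).

Section Forward.
Context (n : nat) (lam : 'I_n -> R) (phi : 'I_n -> X -> R) (phi' : 'I_n -> X' -> R).
Hypothesis basis : orthonormal_eigenbasis G q lam phi.
Hypothesis basis' : orthonormal_eigenbasis G' q' lam phi'.

(** The coefficients of a solution on X solve the scalar equations of X' when the
    eigenvalues and the forcings are the same. *)
Lemma solution_transfer f f' Phi :
  (forall j t, dom t -> mode G (phi j) (f^~ t) = mode G' (phi' j) (f'^~ t)) ->
  solves G q f Phi ->
  solves G' q' f' (fun x t => \sum_j mode G (phi j) (Phi^~ t) * iota (phi' j x)).
Proof.
move=> ff' sPhi.
apply: (solution_of_modes basis' (c := fun j t => mode G (phi j) (Phi^~ t))) => j.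
have [c0 Dc] := solution_modes basis sPhi j; split=> // t dt.
by rewrite -ff'//; exact: Dc.
Qed.

Lemma solutions_agree f f' Phi Phi' x x' :
  (forall j t, dom t -> mode G (phi j) (f^~ t) = mode G' (phi' j) (f'^~ t)) ->
  (forall j, phi j x = phi' j x') ->
  solves G q f Phi -> solves G' q' f' Phi' ->
  forall t, dom t -> Phi x t = Phi' x' t.
Proof.
move=> ff' xx' sPhi sPhi' t dt.
rewrite (solution_unique basis' sPhi' (solution_transfer ff' sPhi) _ dt).
rewrite [LHS](mode_expansion basis (Phi^~ t)).
by apply: eq_bigr => j _; rewrite xx'.
Qed.

End Forward.

End TwoGraphs.

Lemma law_iter_schrodinger (X : finType) (G : wgraph R X) q
    (Phi : X -> T -> K) (l : X -> K) t k : dom t ->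
  (forall x, D (Phi x) t (l x)) ->
  forall x, D (fun s => iter k (schrodinger G q iota) (Phi^~ s) x) t
    (iter k (schrodinger G q iota) l x).
Proof.
move=> dt DPhi; elim: k => //= k IH x.
exact: (law_sum (fun y => iota (kernel G q x y)) dt IH).
Qed.

Lemma iter_schrodinger0 (X : finType) (G : wgraph R X) q k x :
  iter k (schrodinger G q iota) (fun=> 0) x = 0.
Proof.
elim: k x => //= k IH x; rewrite /schrodinger big1// => y _.
by rewrite IH mulr0.
Qed.

Lemma iter_schrodinger_iota (X : finType) (G : wgraph R X) q k u x :
  iter k (schrodinger G q iota) (iota \o u) x =
  iota (iter k (real_schrodinger G q) u x).
Proof.
elim: k x => //= k IH x; rewrite rmorph_sum; apply: eq_bigr => y _.
by rewrite IH rmorphM.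
Qed.

Lemma solution_iter_deriv (X : finType) (G : wgraph R X) q (g : X -> K) Phi k x t :
  solves G q (fun x _ => g x) Phi -> dom t ->
  D (fun s => iter k (schrodinger G q iota) (Phi^~ s) x) t
    (iter k (schrodinger G q iota) g x - iter k.+1 (schrodinger G q iota) (Phi^~ t) x).
Proof.
move=> [_ DPhi] dt.
have -> : iter k (schrodinger G q iota) g x - iter k.+1 (schrodinger G q iota) (Phi^~ t) x =
    iter k (schrodinger G q iota)
      (fun y => (-1) * schrodinger G q iota (Phi^~ t) y + g y) x.
  by rewrite iter_schrodinger_lin -iterSr mulN1r addrC.
apply: law_iter_schrodinger => // y; have [l Dl <-] := DPhi y t dt.
by rewrite mulN1r addrC addrK.
Qed.

(** Induction on k: agreement of H^k Phi at all times gives agreement of its time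
    derivative H^k g - H^(k+1) Phi. At the initial time Phi = 0, so the moments
    H^k g agree, and therefore so does H^(k+1) Phi at all times. *)
Lemma moments_of_solutions (X X' : finType) (G : wgraph R X) (G' : wgraph R X')
    q q' (I : Type) (beta : I -> X) (beta' : I -> X') (g : X -> R) (g' : X' -> R)
    Phi Phi' :
  solves G q (fun x _ => iota (g x)) Phi ->
  solves G' q' (fun x _ => iota (g' x)) Phi' ->
  (forall b t, dom t -> Phi (beta b) t = Phi' (beta' b) t) ->
  forall k b, iter k (real_schrodinger G q) g (beta b) =
              iter k (real_schrodinger G' q') g' (beta' b).
Proof.
move=> s s' agree.
have step k : (forall b t, dom t ->
    iter k (schrodinger G q iota) (Phi^~ t) (beta b) =
    iter k (schrodinger G' q' iota) (Phi'^~ t) (beta' b)) -> forall b,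
    iter k (real_schrodinger G q) g (beta b) =
    iter k (real_schrodinger G' q') g' (beta' b) /\
    forall t, dom t ->
    iter k.+1 (schrodinger G q iota) (Phi^~ t) (beta b) =
    iter k.+1 (schrodinger G' q' iota) (Phi'^~ t) (beta' b).
  move=> IH b.
  have eq_deriv t : dom t ->
      iota (iter k (real_schrodinger G q) g (beta b))
        - iter k.+1 (schrodinger G q iota) (Phi^~ t) (beta b) =
      iota (iter k (real_schrodinger G' q') g' (beta' b))
        - iter k.+1 (schrodinger G' q' iota) (Phi'^~ t) (beta' b).
    move=> dt; rewrite -!iter_schrodinger_iota.
    exact: (law_unique law dt (IH b)
      (solution_iter_deriv k (beta b) s dt) (solution_iter_deriv k (beta' b) s' dt)).
  have eq_moment : iota (iter k (real_schrodinger G q) g (beta b)) =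
      iota (iter k (real_schrodinger G' q') g' (beta' b)).
    have := eq_deriv _ (law_start law).
    have -> : Phi^~ t0 = fun=> 0 by apply/funext => x; exact: s.1.
    have -> : Phi'^~ t0 = fun=> 0 by apply/funext => x; exact: s'.1.
    by rewrite !iter_schrodinger0 !subr0.
  split=> [|t dt]; first exact: fmorph_inj eq_moment.
  by have := eq_deriv t dt; rewrite eq_moment => /addrI/oppr_inj.
have all k : forall b t, dom t ->
    iter k (schrodinger G q iota) (Phi^~ t) (beta b) =
    iter k (schrodinger G' q' iota) (Phi'^~ t) (beta' b).
  elim: k => [|k IH] b t dt; first exact: agree.
  exact: (step k IH b).2.
by move=> k b; exact: (step k (all k) b).1.
Qed.

End Evolution.

(** * The discrete and the continuous heat equation *)

Section DiscreteTime.
Context (R : realType).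

Definition forward_difference (u : nat -> R) (t : nat) (l : R) := l = u t.+1 - u t.

Lemma discrete_law :
  evolution_law (@idfun R : {rmorphism R -> R}) (fun=> True) 0%N forward_difference.
Proof.
rewrite /forward_difference; split=> //= [t _|a u v t l m _ -> ->|u v t l m _ uv -> ->|lam c c0 Dc t _|lam].
- by rewrite subrr.
- ring.
- by rewrite !uv.
- elim: t => // t ct; have := Dc t I; rewrite ct mulr0 oppr0 addr0 => ->//.
- exists (fun t => iter t (fun c => c + (1 - lam * c)) 0); split=> // t _ /=; ring.
Qed.

End DiscreteTime.

Section HalfLine.
Local Open Scope classical_set_scope.
Context (R : realType).
Local Notation halfline t := (within `[(0 : R), +oo[ t^').

Lemma at_right_halfline (t : R) : 0 <= t -> t^'+ --> halfline t.
Proof.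
move=> t0 P h; apply: (@filterS _ (nbhs t)) h => s Ps ts.
apply: Ps; first by rewrite gt_eqF.
by rewrite /= in_itv/= andbT (le_trans t0)// ltW.
Qed.

(** At a positive time the restriction to the half-line is immaterial, so that
    the derivative is two-sided there. *)
Lemma dnbhs_halfline (t : R) : 0 < t -> t^' --> halfline t.
Proof.
move=> t0 P h; apply: (@filterS2 _ t^') h (nbhs_dnbhs (lt_nbhsr t0)).
by move=> s Ps s0; apply: Ps; rewrite /= in_itv/= andbT ltW.
Qed.

Lemma has_deriv_ge0_is_derive (u : R -> R) (t l : R) : 0 < t ->
  has_deriv_ge0 u t l -> is_derive t 1 u l.
Proof.
move=> t0 Du; apply/is_derive1_caratheodory.
pose g s := if s == t then l else (u s - u t) / (s - t).
exists g; split=> [s|/=|]; last by rewrite /g eqxx.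
  rewrite /g; case: eqP => [->|/eqP st]; first by rewrite !subrr mulr0.
  by rewrite divfK// subr_eq0.
apply/continuous_withinNx; rewrite {2}/g eqxx.
apply: cvg_trans (cvg_trans (cvg_app _ (dnbhs_halfline t0)) Du).
apply: near_eq_cvg; near=> s; rewrite /g ifF//; apply/negbTE.
by near: s; exact: nbhs_dnbhs_neq.
Unshelve. all: by end_near. Qed.

Lemma is_derive_has_deriv_ge0 (u : R -> R) (t l : R) :
  is_derive t 1 u l -> has_deriv_ge0 u t l.
Proof.
move=> /is_derive1_caratheodory[g [ug /continuous_withinNx gc gt]].
apply: cvg_within_filter; rewrite -gt; apply: cvg_trans gc.
apply: near_eq_cvg; near=> s; rewrite ug mulfK// subr_eq0.
by near: s; exact: nbhs_dnbhs_neq.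
Unshelve. all: by end_near. Qed.

Lemma has_deriv_ge0_right_continuous (u : R -> R) (l : R) :
  has_deriv_ge0 u 0 l -> u s @[s --> 0^'+] --> u 0.
Proof.
move=> Du; have q := cvg_trans (cvg_app _ (at_right_halfline (lexx 0))) Du.
have id0 : (s : R) @[s --> 0^'+] --> (0 : R).
  exact: cvg_at_right_filter cvg_id.
have : (u s - u 0) / (s - 0) * s + u 0 @[s --> 0^'+] --> l * 0 + u 0.
  by apply: cvgD (cvg_cst _); apply: cvgM.
rewrite mulr0 add0r => h; apply: cvg_trans h.
apply: near_eq_cvg; near=> s => /=; rewrite subr0 divfK ?subrK//.
Unshelve. all: by end_near. Qed.

Lemma is_derive_cvg (w : R -> R) (t d : R) :
  is_derive t 1 w d -> w s @[s --> t] --> w t.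
Proof. by case=> dw _; apply/differentiable_continuous/derivable1_diffP. Qed.

(** Right continuity at 0 lets the mean value theorem reach the initial time,
    where the derivative is only one-sided. *)
Lemma zero_derive_constant (w : R -> R) :
  (forall t : R, 0 < t -> is_derive t 1 w 0) -> w s @[s --> 0^'+] --> w 0 ->
  forall t : R, 0 <= t -> w t = w 0.
Proof.
move=> Dw w0 t; rewrite le_eqVlt => /predU1P[<-//|t0].
have Dc (s : R) : 0 < s -> w z @[z --> s] --> w s by move=> /Dw /is_derive_cvg.
have [] := @MVT _ w (fun=> 0) 0 t t0.
- by move=> s; rewrite in_itv/= => /andP[/Dw].
- apply/continuous_within_itvP => //; split=> //.
    by move=> s; rewrite in_itv/= => /andP[/Dc].
  by apply: cvg_at_left_filter; exact: Dc.
by move=> c _ /eqP; rewrite mul0r subr_eq0 => /eqP.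
Qed.

Lemma has_deriv_ge0_linear a (u v : R -> R) (t l m : R) :
  has_deriv_ge0 u t l -> has_deriv_ge0 v t m ->
  has_deriv_ge0 (fun s => a * u s + v s) t (a * l + m).
Proof.
move=> Du Dv.
have h : a * ((u s - u t) / (s - t)) + (v s - v t) / (s - t) @[s --> halfline t]
    --> a * l + m.
  by apply: cvgD Dv; apply: cvgM Du; exact: cvg_cst.
apply: cvg_trans h.
by apply: near_eq_cvg; near=> s => /=; ring.
Unshelve. all: by end_near. Qed.

(** Uniqueness: if c' = - lam c then exp (lam t) c is constant. *)
Lemma heat_law : evolution_law (@idfun R : {rmorphism R -> R})
  (fun t : R => 0 <= t) 0 (@has_deriv_ge0 R).
Proof.
split=> //= [t t0|a u v t l m _|u v t l m t0 uv Du Dv|lam c c0 Dc t t0|lam].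
- by apply: is_derive_has_deriv_ge0; exact: is_derive_cst.
- exact: has_deriv_ge0_linear.
- have Du' := cvg_trans (cvg_app _ (at_right_halfline t0)) Du.
  have Dv' := cvg_trans (cvg_app _ (at_right_halfline t0)) Dv.
  apply: (cvg_unique _ Du'); first exact: Rhausdorff.
  apply: cvg_trans Dv'; apply: near_eq_cvg; near=> s; rewrite !uv//.
  by apply: le_trans t0 _; apply: ltW; near: s; exact: nbhs_right_gt.
- pose w s := expR (lam * s) * c s.
  have De (s : R) : is_derive s 1 (fun s => expR (lam * s)) (lam * expR (lam * s)).
    by apply: is_derive_eq; rewrite /GRing.scale/=; ring.
  have : w t = w 0.
    apply: zero_derive_constant => // [s s0|].
      have Dcs := has_deriv_ge0_is_derive s0 (Dc s (ltW s0)).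
      by apply: is_derive_eq; rewrite /GRing.scale/=; ring.
    apply: cvgM; last exact: has_deriv_ge0_right_continuous (Dc 0 (lexx 0)).
    exact: (cvg_at_right_filter (is_derive_cvg (De 0))).
  by rewrite /w c0 mulr0 => /eqP; rewrite mulf_eq0 gt_eqF ?expR_gt0//= => /eqP.
- have [->|lam0] := eqVneq lam 0.
    exists id; split=> // t _; rewrite mul0r subr0.
    exact: is_derive_has_deriv_ge0.
  exists (fun t => (1 - expR (- lam * t)) / lam); split=> [|t _].
    by rewrite mulr0 expR0 subrr mul0r.
  apply: is_derive_has_deriv_ge0.
  by apply: is_derive_eq; rewrite /GRing.scale/=; field.
Unshelve. all: by end_near. Qed.

End HalfLine.

(** * The continuous Schrodinger equation *)

Section ComplexTime.
Local Open Scope classical_set_scope.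
Local Open Scope complex_scope.
Context (R : realType).
Local Notation halfline t := (within `[(0 : R), +oo[ t^').

Lemma normc_real (x : R) : `|x%:C| = `|x|%:C.
Proof.
by rewrite normc_def /= expr0n addr0 sqrtr_sqr.
Qed.

Lemma cvg_real_complex (T : Type) (F : set_system T) {FF : Filter F} (f : T -> R) (l : R) :
  f x @[x --> F] --> l -> ((f x)%:C : (R[i])^o) @[x --> F] --> (l%:C : (R[i])^o).
Proof.
move=> /cvgrPdist_lt fl; apply/cvgrPdist_lt => e e0.
have eE : e = (complex.Re e)%:C by rewrite RRe_real// gtr0_real.
have e0' : 0 < complex.Re e by move: e0; rewrite eE ltcR.
apply: filterS (fl _ e0') => x h; rewrite eE -rmorphB.
suff : `|(l - f x)%:C| < (complex.Re e)%:C by [].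
by rewrite normc_real ltcR.
Qed.

Lemma cvg_Re (T : Type) (F : set_system T) {FF : Filter F} (f : T -> (R[i])^o) (l : (R[i])^o) :
  f x @[x --> F] --> l -> complex.Re (f x) @[x --> F] --> complex.Re l.
Proof.
move=> /cvgrPdist_lt fl; apply/cvgrPdist_lt => e e0.
have e0' : 0 < (e%:C : R[i]) by rewrite ltcR.
apply: filterS (fl _ e0') => x h; rewrite -raddfB -ltcR.
exact: le_lt_trans (normc_ge_Re _) h.
Qed.

Lemma cvg_Im (T : Type) (F : set_system T) {FF : Filter F} (f : T -> (R[i])^o) (l : (R[i])^o) :
  f x @[x --> F] --> l -> complex.Im (f x) @[x --> F] --> complex.Im l.
Proof.
move=> fl; have ImE (z : R[i]) : complex.Im z = complex.Re (- 'i * z).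
  by case: z => a b /=; ring.
have h : (- 'i *: f x : (R[i])^o) @[x --> F] --> (- 'i *: l : (R[i])^o).
  exact: cvgZl_tmp.
by rewrite ImE; under eq_fun do rewrite ImE; exact: cvg_Re h.
Qed.

Lemma quotient_part (u : R -> R[i]) (t s : R) :
  (complex.Re ((u s - u t) / (s - t)%:C) =
     (complex.Re (u s) - complex.Re (u t)) / (s - t)) /\
  (complex.Im ((u s - u t) / (s - t)%:C) =
     (complex.Im (u s) - complex.Im (u t)) / (s - t)).
Proof.
rewrite -fmorphV; case: (u s) (u t) => a b [c d] /=; split; ring.
Qed.

(** Reduces complex derivatives to the real ones, where the mean value theorem
    and the derivatives of the elementary functions are available. *)
Lemma has_cderiv_ge0P (u : R -> R[i]) (t : R) (l : R[i]) :
  has_cderiv_ge0 u t l <->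
  has_deriv_ge0 (fun s => complex.Re (u s)) t (complex.Re l) /\
  has_deriv_ge0 (fun s => complex.Im (u s)) t (complex.Im l).
Proof.
split=> [Du|[Da Db]].
  split; [move/cvg_Re: Du|move/cvg_Im: Du]; apply: cvg_trans;
  apply: near_eq_cvg; near=> s; by have [] := quotient_part u t s.
have h1 : (((complex.Re (u s) - complex.Re (u t)) / (s - t))%:C : (R[i])^o)
    @[s --> halfline t] --> ((complex.Re l)%:C : (R[i])^o).
  exact: cvg_real_complex.
have h2 : 'i *: (((complex.Im (u s) - complex.Im (u t)) / (s - t))%:C : (R[i])^o)
    @[s --> halfline t] --> ('i *: ((complex.Im l)%:C : (R[i])^o) : (R[i])^o).
  by apply: cvgZl_tmp; exact: cvg_real_complex.
have h : (((complex.Re (u s) - complex.Re (u t)) / (s - t))%:C : (R[i])^o) +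
    'i *: (((complex.Im (u s) - complex.Im (u t)) / (s - t))%:C : (R[i])^o)
    @[s --> halfline t] --> ((complex.Re l)%:C : (R[i])^o) + 'i *: ((complex.Im l)%:C : (R[i])^o).
  exact: cvgD h1 h2.
have -> : l = ((complex.Re l)%:C + 'i *: ((complex.Im l)%:C : (R[i])^o) : (R[i])^o).
  exact: complexE.
apply: cvg_trans h; apply: near_eq_cvg; near=> s.
have [<- <-] := quotient_part u t s.
by rewrite [RHS]complexE.
Unshelve. all: by end_near. Qed.

(** The operator i d/dt: its value is l when the derivative is l / i = - i l. *)
Definition ideriv_ge0 (u : R -> R[i]) (t : R) (l : R[i]) :=
  has_cderiv_ge0 u t (- 'i * l).

(** Uniqueness: i c' = - lam c conserves |c|^2. Existence: the equation
    i c' + lam c = 1 is solved by (1 - exp (i lam t)) / lam, and by - i t when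
    lam = 0. *)
Lemma schrodinger_law : evolution_law (@real_complex R : {rmorphism R -> R[i]})
  (fun t : R => 0 <= t) 0 ideriv_ge0.
Proof.
have heat := heat_law R.
split=> //= [t t0|a u v t l m t0 Du Dv|u v t l m t0 uv Du Dv|lam c c0 Dc t t0|lam].
- apply/has_cderiv_ge0P; rewrite mulr0.
  split; exact: (law_zero heat).
- have [Du1 Du2] := (has_cderiv_ge0P _ _ _).1 Du.
  have [Dv1 Dv2] := (has_cderiv_ge0P _ _ _).1 Dv.
  apply/has_cderiv_ge0P; split.
  + rewrite (_ : complex.Re _ = complex.Re a * complex.Re (- 'i * l) +
      (- complex.Im a * complex.Im (- 'i * l) + complex.Re (- 'i * m))).
      rewrite (_ : (fun s => _) = fun s => complex.Re a * complex.Re (u s) +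
        (- complex.Im a * complex.Im (u s) + complex.Re (v s))).
        by do 2 apply: has_deriv_ge0_linear => //.
      by apply/funext => s; case: (a) (u s) (v s) => ? ? [? ?] [? ?] /=; ring.
    by case: (a) (l) (m) => ? ? [? ?] [? ?] /=; ring.
  + rewrite (_ : complex.Im _ = complex.Re a * complex.Im (- 'i * l) +
      (complex.Im a * complex.Re (- 'i * l) + complex.Im (- 'i * m))).
      rewrite (_ : (fun s => _) = fun s => complex.Re a * complex.Im (u s) +
        (complex.Im a * complex.Re (u s) + complex.Im (v s))).
        by do 2 apply: has_deriv_ge0_linear => //.
      by apply/funext => s; case: (a) (u s) (v s) => ? ? [? ?] [? ?] /=; ring.
    by case: (a) (l) (m) => ? ? [? ?] [? ?] /=; ring.
- have [Du1 Du2] := (has_cderiv_ge0P _ _ _).1 Du.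
  have [Dv1 Dv2] := (has_cderiv_ge0P _ _ _).1 Dv.
  have uvR s : 0 <= s -> complex.Re (u s) = complex.Re (v s) by move=> /uv ->.
  have uvI s : 0 <= s -> complex.Im (u s) = complex.Im (v s) by move=> /uv ->.
  have := law_unique heat t0 uvR Du1 Dv1; have := law_unique heat t0 uvI Du2 Dv2.
  case: l m {Du Dv Du1 Du2 Dv1 Dv2} => a b [c d] /= e1 e2.
  by congr (_ +i* _); lra.
- pose a s := complex.Re (c s); pose b s := complex.Im (c s).
  have Dab s : 0 <= s -> has_deriv_ge0 a s (- lam * b s) /\ has_deriv_ge0 b s (lam * a s).
    have [eRe eIm] : complex.Re (- 'i * - (lam%:C * c s)) = - lam * b s /\
        complex.Im (- 'i * - (lam%:C * c s)) = lam * a s.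
      by rewrite /a /b; case: (c s) => x y /=; split; ring.
    by move=> /Dc/has_cderiv_ge0P; rewrite eRe eIm.
  have [Da0 Db0] := Dab 0 (lexx 0).
  have w0 : a t * a t + b t * b t = a 0 * a 0 + b 0 * b 0.
    apply: (zero_derive_constant (w := fun s => a s * a s + b s * b s)) => // [s s0|].
      have [/(has_deriv_ge0_is_derive s0) ? /(has_deriv_ge0_is_derive s0) ?] := Dab s (ltW s0).
      by apply: is_derive_eq; rewrite /GRing.scale/=; ring.
    by apply: cvgD; apply: cvgM; apply: has_deriv_ge0_right_continuous; eassumption.
  have : a t ^+ 2 + b t ^+ 2 == 0.
    by rewrite !expr2 w0 /a /b c0 /= !mul0r addr0.
  rewrite paddr_eq0 ?sqr_ge0// !sqrf_eq0 /a /b => /andP[/eqP + /eqP].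
  by case: (c t) => ? ? /= -> ->.
- have [->|lam0] := eqVneq lam 0.
    exists (fun t => 0 +i* (- t)); split=> [|t _]; first by rewrite oppr0.
    apply/has_cderiv_ge0P => /=; split.
      rewrite (_ : _ - _ = 0); last by ring.
      by apply: is_derive_has_deriv_ge0; exact: is_derive_cst.
    by apply: is_derive_has_deriv_ge0; apply: is_derive_eq; ring.
  exists (fun t => ((1 - cos (lam * t)) / lam) +i* (- sin (lam * t) / lam)).
  split=> [|t _]; first by rewrite mulr0 cos0 sin0 subrr oppr0 !mul0r.
  apply/has_cderiv_ge0P => /=; split; apply: is_derive_has_deriv_ge0;
  by apply: is_derive_eq; rewrite /GRing.scale/=; field.
Unshelve. all: by end_near. Qed.

End ComplexTime.

(** * Source-to-solution maps and spectral data *)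

(** What is known of a solution picked by [get]: it solves the problem if that is
    possible, and takes a default value d otherwise. *)
Definition selects (A T E V : Type) (S : E -> set (A -> T -> V)) (d : V)
    (sel : E -> A -> T -> V) : Prop :=
  forall f, ((exists Phi, S f Phi) -> S f (sel f)) /\
    (~ (exists Phi, S f Phi) -> forall x t, sel f x t = d).

Section Measurement.
Context (R : realType) (K : comNzRingType) (iota : {rmorphism R -> K}).
Context (T : Type) (dom : T -> Prop) (t0 : T) (D : (T -> K) -> T -> K -> Prop).
Hypothesis law : evolution_law iota dom t0 D.
Context (admissible : (T -> K) -> Prop).
Hypothesis admissible_cst : forall a : K, admissible (fun=> a).

Definition source (X : finType) (B : {set X}) (f : X -> T -> K) : Prop :=
  (forall x t, x \notin B -> dom t -> f x t = 0) /\ forall x, admissible (f x).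

Lemma mode_on (X : finType) (G : wgraph R X) (B : {set X}) phi (u : X -> K) :
  (forall x, x \notin B -> u x = 0) ->
  mode iota G phi u =
  \sum_(b : {x | x \in B}) iota (mu G (val b)) * u (val b) * iota (phi (val b)).
Proof.
move=> u0; rewrite /mode /dot (bigID (mem B))/= [X in _ + X]big1 ?addr0; last first.
  by move=> x /u0 ->; rewrite mulr0 mul0r.
exact: big_sub.
Qed.

Context (X X' : finType) (G : wgraph R X) (G' : wgraph R X').
Context (q : X -> R) (q' : X' -> R) (B : {set X}) (B' : {set X'}).
Context (Phi0 : {x | x \in B} -> {x | x \in B'}).
Hypothesis observable : no_vanishing_eigenfunction G q B.
Hypothesis observable' : no_vanishing_eigenfunction G' q' B'.
Hypothesis Phi0_bij : bijective Phi0.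
Hypothesis mu_eq : forall b, mu G' (val (Phi0 b)) = mu G (val b).

(** For sources living on B, the forcing of each mode only depends on data
    on B. *)
Lemma mode_transfer (phi : X -> R) (phi' : X' -> R) (u : X -> K) (u' : X' -> K) :
  (forall x, x \notin B -> u x = 0) -> (forall x, x \notin B' -> u' x = 0) ->
  (forall b, u' (val (Phi0 b)) = u (val b)) ->
  (forall b : {x | x \in B}, phi (val b) = phi' (val (Phi0 b))) ->
  mode iota G phi u = mode iota G' phi' u'.
Proof.
move=> u0 u'0 uu' pp'; rewrite (mode_on G _ u0) (mode_on G' _ u'0).
rewrite [RHS](reindex Phi0); last exact: onW_bij.
by apply: eq_bigr => b _; rewrite mu_eq uu' pp'.
Qed.

Context (sel : (X -> T -> K) -> X -> T -> K) (sel' : (X' -> T -> K) -> X' -> T -> K).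
Context (d : K).
Hypothesis sel_selects : selects (solves iota dom t0 D G q) d sel.
Hypothesis sel'_selects : selects (solves iota dom t0 D G' q') d sel'.

Definition measurements_coincide : Prop :=
  forall f f', source B f -> source B' f' ->
  (forall b t, dom t -> f' (val (Phi0 b)) t = f (val b) t) ->
  forall b t, dom t -> t <> t0 -> sel f (val b) t = sel' f' (val (Phi0 b)) t.

(** Solvability passes from one graph to the other with the solutions. If neither
    source is solvable, both maps take the default value. *)
Lemma spectral_data_measurements :
  spectral_data_coincide G G' q q' Phi0 -> measurements_coincide.
Proof.
move=> [n [lam [phi [phi' [basis basis' pp']]]]] f f' [fB _] [fB' _] ff' b t dt _.
have modes j s : dom s ->
    mode iota G (phi j) (f^~ s) = mode iota G' (phi' j) (f'^~ s).
  move=> ds; apply: mode_transfer => [x xB|x xB|c|c].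
  - exact: fB.
  - exact: fB'.
  - exact: ff'.
  - exact: pp'.
have [yes no] := sel_selects f; have [yes' no'] := sel'_selects f'.
have [ex|nex] := pselect (exists Phi, solves iota dom t0 D G q f Phi).
  have ex' : exists Phi', solves iota dom t0 D G' q' f' Phi'.
    by case: ex => Phi sPhi; eexists; exact: (solution_transfer law basis basis' modes sPhi).
  apply: (solutions_agree law basis basis' modes) dt => //; [exact: yes|exact: yes'].
rewrite no// no'// => -[Phi' sPhi']; apply: nex; eexists.
by apply: (solution_transfer law basis' basis _ sPhi') => j s /modes.
Qed.

(** The sources are the indicators of the vertices of B, constant in time; they
    are solvable because [law_mode_exists] solves them mode by mode. *)
Lemma measurements_spectral_data :
  measurements_coincide -> spectral_data_coincide G G' q q' Phi0.
Proof.
move=> agree; apply: moments_to_spectral_data => // k b c.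
pose e := indicator (val c) : X -> R; pose e' := indicator (val (Phi0 c)) : X' -> R.
have [lam [phi basis]] := spectral_theorem G q.
have [lam' [phi' basis']] := spectral_theorem G' q'.
have [/(_ (constant_source_solvable law basis (iota \o e))) s _] :=
  sel_selects (fun x _ => iota (e x)).
have [/(_ (constant_source_solvable law basis' (iota \o e'))) s' _] :=
  sel'_selects (fun x _ => iota (e' x)).
apply: (moments_of_solutions law (beta := val) (beta' := fun b => val (Phi0 b)) s s') => a t dt.
have [->|tt0] := pselect (t = t0); first by rewrite s.1 s'.1.
apply: agree => //.
- split=> // x r xB _; rewrite /e /indicator.
  by case: eqP xB => [->|]; rewrite ?(valP c)// rmorph0.
- split=> // x r xB _; rewrite /e' /indicator.
  by case: eqP xB => [->|]; rewrite ?(valP (Phi0 c))// rmorph0.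
move=> {}a r _; rewrite /e /e' /indicator !val_eqE.
by rewrite (bij_eq Phi0_bij).
Qed.

Lemma spectral_data_iff_measurements :
  spectral_data_coincide G G' q q' Phi0 <-> measurements_coincide.
Proof.
by split; [exact: spectral_data_measurements|exact: measurements_spectral_data].
Qed.

End Measurement.

Lemma get_selects (T E A : Type) (K : pointedType) (S S' : E -> set (A -> T -> K)) :
  (forall f Phi, S f Phi <-> S' f Phi) ->
  selects S' point (fun f => get (S f)).
Proof.
move=> SS' f; split=> [[Phi /SS' sPhi]|no x t]; first by apply/SS'; apply: getPex; exists Phi.
by rewrite xgetPN// => Phi /SS' sPhi; apply: no; exists Phi.
Qed.

Section Instances.
Local Open Scope complex_scope.
Context (R : realType) (X : finType) (G : wgraph R X) (q : X -> R).

Lemma solution_cP f Phi : solution_c G q f Phi <->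
  solves (@idfun R : {rmorphism R -> R}) (fun t : R => 0 <= t) 0 (@has_deriv_ge0 R) G q f Phi.
Proof.
split=> -[Phi0 e]; split=> // x t /(e x)[l Dl <-]; exists l => //.
  by rewrite schrodingerE addrA.
by rewrite schrodingerE addrA.
Qed.

Lemma solution_sP f Psi : solution_s G q f Psi <->
  solves (@real_complex R : {rmorphism R -> R[i]}) (fun t : R => 0 <= t) 0 (@ideriv_ge0 R) G q f Psi.
Proof.
have ii (z : R[i]) : - 'i * ('i * z) = z by rewrite mulNr mulrA -expr2 sqr_i mulN1r opprK.
have ii' (z : R[i]) : 'i * (- 'i * z) = z by rewrite mulrCA ii.
split=> -[Psi0 e]; split=> // x t /(e x)[l Dl <-].
  exists ('i * l); first by rewrite /ideriv_ge0 ii.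
  by rewrite schrodingerE addrA.
exists (- 'i * l) => //.
by rewrite schrodingerE addrA; congr (_ + _); congr (_ + _); exact: ii'.
Qed.

Lemma solution_dP f u : solution_d G q f u <->
  solves (@idfun R : {rmorphism R -> R}) (fun _ : nat => True) 0%N (@forward_difference R) G q f u.
Proof.
split=> -[u0 e]; split=> // x t.
  by move=> _; exists (u x t.+1 - u x t) => //; rewrite schrodingerE addrA; exact: e.
by have [l -> <-] := e x t I; rewrite schrodingerE addrA.
Qed.

End Instances.

Section SourceToSolutionMaps.
Local Open Scope classical_set_scope.
Local Open Scope complex_scope.
Context (R : realType) (X X' : finType) (G : wgraph R X) (G' : wgraph R X').
Context (q : X -> R) (q' : X' -> R) (B : {set X}) (B' : {set X'}).
Context (Phi0 : {x | x \in B} -> {x | x \in B'}).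
Hypothesis observable : no_vanishing_eigenfunction G q B.
Hypothesis observable' : no_vanishing_eigenfunction G' q' B'.
Hypothesis Phi0_bij : bijective Phi0.
Hypothesis mu_eq : forall b, mu G' (val (Phi0 b)) = mu G (val b).

Lemma spectral_data_iff_Lambda_c :
  spectral_data_coincide G G' q q' Phi0 <-> Lambda_c_coincide G G' q q' Phi0.
Proof.
have -> := @spectral_data_iff_measurements _ _ _ _ _ _ _ (heat_law R)
  (fun u : R -> R => {within `[0, +oo[, continuous u})
  (fun a => @cst_continuous _ _ a)
  _ _ G G' q q' B B' Phi0 observable observable' Phi0_bij mu_eq _ _ _
  (get_selects (@solution_cP _ _ G q)) (get_selects (@solution_cP _ _ G' q')).
split=> agree f f' sf sf' ff' b t t_ge0.
  by apply: agree => //; [exact: ltW|exact/eqP/lt0r_neq0].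
by move/eqP=> t_neq0; apply: agree => //; rewrite lt_neqAle eq_sym t_neq0.
Qed.

Lemma spectral_data_iff_Lambda_s :
  spectral_data_coincide G G' q q' Phi0 <-> Lambda_s_coincide G G' q q' Phi0.
Proof.
have -> := @spectral_data_iff_measurements _ _ _ _ _ _ _ (schrodinger_law R)
  (fun u : R -> (R[i])^o => {within `[0, +oo[, continuous u})
  (fun a => @cst_continuous _ (R[i])^o a)
  _ _ G G' q q' B B' Phi0 observable observable' Phi0_bij mu_eq _ _ _
  (get_selects (@solution_sP _ _ G q)) (get_selects (@solution_sP _ _ G' q')).
split=> agree f f' sf sf' ff' b t t_ge0.
  by apply: agree => //; [exact: ltW|exact/eqP/lt0r_neq0].
by move/eqP=> t_neq0; apply: agree => //; rewrite lt_neqAle eq_sym t_neq0.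
Qed.

Lemma spectral_data_iff_Lambda_d :
  spectral_data_coincide G G' q q' Phi0 <-> Lambda_d_coincide G G' q q' Phi0.
Proof.
have -> := @spectral_data_iff_measurements _ _ _ _ _ _ _ (discrete_law R)
  (fun=> True) (fun=> I)
  _ _ G G' q q' B B' Phi0 observable observable' Phi0_bij mu_eq _ _ _
  (get_selects (@solution_dP _ _ G q)) (get_selects (@solution_dP _ _ G' q')).
split=> agree f f' sf sf' ff' b t.
  move=> t_gt0; apply: agree => //; last by move=> t0; rewrite t0 in t_gt0.
    by split=> // x s xB _; exact: sf.
  by split=> // x s xB _; exact: sf'.
move=> _ /eqP t_neq0; apply: agree => //; last by rewrite lt0n.
- by move=> x s xB; exact: sf.1.
- by move=> x s xB; exact: sf'.1.
- by move=> c s; exact: ff'.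
Qed.

End SourceToSolutionMaps.

Theorem theorem1p8 (R : realType) (X X' : finType)
    (G : wgraph R X) (G' : wgraph R X') (q : X -> R) (q' : X' -> R)
    (B : {set X}) (B' : {set X'})
    (Phi0 : {x | x \in B} -> {x | x \in B'}) :
  no_vanishing_eigenfunction G q B ->
  no_vanishing_eigenfunction G' q' B' ->
  bijective Phi0 ->
  (forall b, mu G' (val (Phi0 b)) = mu G (val b)) ->
  [<-> spectral_data_coincide G G' q q' Phi0;
       Lambda_c_coincide G G' q q' Phi0;
       Lambda_s_coincide G G' q q' Phi0;
       Lambda_d_coincide G G' q q' Phi0].
Proof.
move=> obs obs' bij mu_eq.
have heat := spectral_data_iff_Lambda_c obs obs' bij mu_eq.
have schr := spectral_data_iff_Lambda_s obs obs' bij mu_eq.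
have disc := spectral_data_iff_Lambda_d obs obs' bij mu_eq.
by tfae; [move=> /heat|move=> /heat/schr|move=> /schr/disc|move=> /disc].
Qed.
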